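(* The combination $\Omega_C+\mathsf{S}^2$ computes a functional which, on input a lower semi-continuous $f:[0,1]\to\mathbb{R}$, decides whether $f$ is continuous on $[0,1]$. Conversely, given $\exists^2$, any functional with this specification computes $\Omega_C$.
   Context: Computability is Kleene's higher-order computability (S1–S9), extended to partial functionals. $\exists^2:\mathbb{N}^{\mathbb{N}}\to\{0,1\}$ satisfies $\exists^2(g)=0\leftrightarrow(\exists n)(g(n)=0)$. The Suslin functional $\mathsf{S}^2:\mathbb{N}^{\mathbb{N}}\to\{0,1\}$ satisfies $\mathsf{S}(f)=0\leftrightarrow(\exists g\in\mathbb{N}^{\mathbb{N}})(\forall n)(f(\overline{g}n)=0)$, where $\overline{g}n$ codes the finite sequence $g(0),\dots,g(n-1)$. Sets are given by characteristic functions; closed sets in $2^{\mathbb{N}}$ have open complement. $\Omega_C$ is defined exactly on closed $X\subseteq2^{\mathbb{N}}$, with value $0$ if $X=\emptyset$ and $1$ otherwise. $f$ is lower semi-continuous if $f(x_0)\le\liminf_{x\to x_0}f(x)$ for all $x_0$. *)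

(* Defs.v *)
From HB Require Import structures.
From mathcomp Require Import all_boot all_order all_algebra.
From mathcomp Require Import all_classical all_reals all_analysis.
Import Order.TTheory GRing.Theory Num.Theory.
Import numFieldNormedType.Exports.

Set Implicit Arguments.
Unset Strict Implicit.
Unset Printing Implicit Defensive.

Local Open Scope classical_set_scope.

Definition ftype1 := nat -> nat.
Definition ftype2 := ftype1 -> nat.
(** Partial functionals of type 3, taking total arguments. *)
Definition ftype3 := ftype2 -> option nat.

(** * Kleene's schemes S1-S9 *)

Record args := Args {
  args0 : seq nat;
  args1 : seq ftype1;
  args2 : seq ftype2;
  args3 : seq ftype3 }.

Definition add0 x (a : args) := Args (x :: args0 a) (args1 a) (args2 a) (args3 a).
Definition add1 x (a : args) := Args (args0 a) (x :: args1 a) (args2 a) (args3 a).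
Definition add2 x (a : args) := Args (args0 a) (args1 a) (x :: args2 a) (args3 a).
Definition add3 x (a : args) := Args (args0 a) (args1 a) (args2 a) (x :: args3 a).

Definition cat_args (a b : args) :=
  Args (args0 a ++ args0 b) (args1 a ++ args1 b)
       (args2 a ++ args2 b) (args3 a ++ args3 b).

(** [CodeSeq.code] is a primitive recursive bijection from [seq nat] to [nat]. *)
Notation "⟨ s ⟩" := (CodeSeq.code s) (at level 0, s at level 99, format "⟨ s ⟩").

Definition signature (a : args) : nat :=
  ⟨[:: size (args0 a); size (args1 a); size (args2 a); size (args3 a)]⟩.

(** The list [s] with its entry of index [k < size s] moved to the front. *)
Definition to_front T (k : nat) (s : seq T) : seq T :=
  rotr 1 (take k.+1 s) ++ drop k.+1 s.

(** [kleene e a v] is [{e}(a) = v].  In [S8_3] the value [{e}(a)] is defined only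
    if the argument fed to the partial functional is total and in its domain. *)
Inductive kleene : nat -> args -> nat -> Prop :=
| S1 x b :
    kleene ⟨[:: 1; signature (add0 x b)]⟩ (add0 x b) x.+1
| S2 q a :
    kleene ⟨[:: 2; signature a; q]⟩ a q
| S3 x b :
    kleene ⟨[:: 3; signature (add0 x b)]⟩ (add0 x b) x
| S4 g h b u v :
    kleene h b u -> kleene g (add0 u b) v ->
    kleene ⟨[:: 4; signature b; g; h]⟩ b v
| S5_0 g h b v :
    kleene g b v ->
    kleene ⟨[:: 5; signature (add0 0 b); g; h]⟩ (add0 0 b) v
| S5_S g h x b u v :
    kleene ⟨[:: 5; signature (add0 x b); g; h]⟩ (add0 x b) u ->
    kleene h (add0 x (add0 u b)) v ->
    kleene ⟨[:: 5; signature (add0 x.+1 b); g; h]⟩ (add0 x.+1 b) v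
| S6_0 k g a v :
    k < size (args0 a) ->
    kleene g (Args (to_front k (args0 a)) (args1 a) (args2 a) (args3 a)) v ->
    kleene ⟨[:: 6; signature a; 0; k; g]⟩ a v
| S6_1 k g a v :
    k < size (args1 a) ->
    kleene g (Args (args0 a) (to_front k (args1 a)) (args2 a) (args3 a)) v ->
    kleene ⟨[:: 6; signature a; 1; k; g]⟩ a v
| S6_2 k g a v :
    k < size (args2 a) ->
    kleene g (Args (args0 a) (args1 a) (to_front k (args2 a)) (args3 a)) v ->
    kleene ⟨[:: 6; signature a; 2; k; g]⟩ a v
| S6_3 k g a v :
    k < size (args3 a) ->
    kleene g (Args (args0 a) (args1 a) (args2 a) (to_front k (args3 a))) v ->
    kleene ⟨[:: 6; signature a; 3; k; g]⟩ a v
| S7 (f : ftype1) x b :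
    kleene ⟨[:: 7; signature (add1 f (add0 x b))]⟩ (add1 f (add0 x b)) (f x)
| S8_2 (F : ftype2) (f : ftype1) h b :
    (forall x, kleene h (add2 F (add0 x b)) (f x)) ->
    kleene ⟨[:: 8; signature (add2 F b); 2; h]⟩ (add2 F b) (F f)
| S8_3 (Psi : ftype3) (F : ftype2) h b v :
    (forall f, kleene h (add3 Psi (add1 f b)) (F f)) ->
    Psi F = Some v ->
    kleene ⟨[:: 8; signature (add3 Psi b); 3; h]⟩ (add3 Psi b) v
| S9 x b c v :
    kleene x b v ->
    kleene ⟨[:: 9; signature (add0 x (cat_args b c)); signature b]⟩
      (add0 x (cat_args b c)) v.

(** [Psi] and [G] together compute the partial functional [Theta]: one index
    gives the value of [Theta] throughout its domain. *)
Definition computes (Psi : ftype3) (G : ftype2) (Theta : ftype3) : Prop :=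
  exists e : nat, forall (F : ftype2) (v : nat),
    Theta F = Some v -> kleene e (Args [::] [::] [:: G; F] [:: Psi]) v.

(** * The functionals *)

Definition exists_2 : ftype2 := fun g =>
  if `[< exists n, g n = 0 >] then 0 else 1.

Definition suslin : ftype2 := fun f =>
  if `[< exists g : nat -> nat, forall n, f ⟨mkseq g n⟩ = 0 >] then 0 else 1.

(** Only the values of [F] on 0-1-valued sequences matter: [F] is a characteristic
    function when these values are 0 or 1, and then the set is [cantor_set F]. *)
Definition bits (x : cantor_space) : ftype1 := fun n => nat_of_bool (x n).

Definition is_char (F : ftype2) : Prop := forall x, (F (bits x) <= 1)%N.

Definition cantor_set (F : ftype2) : set cantor_space := [set x | F (bits x) = 1].

Definition Omega_C : ftype3 := fun F =>
  if `[< is_char F /\ closed (cantor_set F) >]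
  then Some (if `[< cantor_set F = set0 >] then 0 else 1)
  else None.

(** * Real functions as inputs *)

Local Open Scope ring_scope.

Section RealInputs.
Variable R : realType.

(** Every rational is [ratval n] for some [n]. *)
Definition ratval (n : nat) : R :=
  let s := CodeSeq.decode n in
  ((nth 0%N s 0)%:R - (nth 0%N s 1)%:R) / (nth 0%N s 2).+1%:R.

(** [a] is a fast-converging sequence of rationals with limit [x]. *)
Definition real_name (a : ftype1) (x : R) : Prop :=
  forall n, `|ratval (a n) - x| <= 2 ^- n.

Definition fcons (n : nat) (a : ftype1) : ftype1 :=
  fun k => if k is k'.+1 then a k' else n.

(** A map on names, of type [ftype1 -> ftype1], is given as the type 2 functional
    that sends [fcons n a] to the [n]-th entry of the image of [a]. *)
Definition represents (F : ftype2) (f : R -> R) : Prop :=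
  forall a (x : R), x \in `[0, 1] -> real_name a x ->
    real_name (fun n => F (fcons n a)) (f x).

(** The limit inferior is taken inside [0, 1]. *)
Definition lsc01 (f : R -> R) : Prop :=
  forall x0 : R, x0 \in `[0, 1] ->
    ((f x0)%:E <= limf_einf (fun x => (f x)%:E) (within `[0%R, 1%R] x0^'))%E.

Definition decides_continuity_of_lsc (Phi : ftype3) : Prop :=
  forall (F : ftype2) (f : R -> R), represents F f -> lsc01 f ->
    Phi F = Some (if `[< {within `[0, 1], continuous f} >] then 1%N else 0%N).

End RealInputs.

(* Main.v *)
(** A Kleene index mentions the signature of its arguments, so programs are built
    over families of arguments of constant signature; there the computable
    functions are closed under composition, primitive recursion and, with [exists_2]
    or [suslin] among the arguments, number quantifiers.

    A lower semi-continuous [f] is discontinuous iff for some rationals [p < q] there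
    is [x] with [f x <= p] in the closure of the open set [f > q], equivalently of its
    rational points. Pulled back along the binary expansion map, the set of these [x] is
    a closed subset of Cantor space, arithmetical in [f], so [Omega_C] decides whether
    it is empty. Conversely, embed a closed subset of Cantor space in [[0, 1]] by reading
    sequences in base 4: one minus the indicator of the image is lower semi-continuous,
    and by the intermediate value theorem it is continuous iff the set is empty. *)
Require Import Defs.
From mathcomp Require Import all_boot all_order all_algebra.
From mathcomp Require Import all_classical all_reals all_analysis.
From mathcomp Require Import zify ring lra.
Import Order.TTheory GRing.Theory Num.Theory.
Import numFieldNormedType.Exports.

Set Implicit Arguments.
Unset Strict Implicit.
Unset Printing Implicit Defensive.

(** * Programming with S1-S9 *)

Definition sizes (a : args) : seq nat :=
  [:: size (args0 a); size (args1 a); size (args2 a); size (args3 a)].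

(** The four cases of S6 as one operation indexed by the type [j], so that reordering is treated
    once for all types. *)
Definition front (j k : nat) (a : args) : args :=
  match j with
  | 0 => Args (to_front k (args0 a)) (args1 a) (args2 a) (args3 a)
  | 1 => Args (args0 a) (to_front k (args1 a)) (args2 a) (args3 a)
  | 2 => Args (args0 a) (args1 a) (to_front k (args2 a)) (args3 a)
  | _ => Args (args0 a) (args1 a) (args2 a) (to_front k (args3 a))
  end.

Lemma size_to_front T k (s : seq T) : size (to_front k s) = size s.
Proof. by rewrite /to_front size_cat size_rotr -size_cat cat_take_drop. Qed.

Lemma sizes_front j k a : sizes (front j k a) = sizes a.
Proof. by case: j => [|[|[|j]]]; rewrite /sizes /= size_to_front. Qed.

Lemma rotr1_iter T (s : seq T) : iter (size s) (rotr 1) s = s.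
Proof.
have rot_iter n : n <= size s -> iter n (rot 1) s = rot n s.
  elim: n => [|n IHn] ltn; first by rewrite rot0.
  by rewrite iterS IHn 1?ltnW// -rotS.
have: cancel (iter (size s) (rot 1)) (iter (size s) (rotr (T := T) 1)).
  elim: (size s) => [//|n IHn x].
  by rewrite (iterS n (rot 1)) iterSr rotK IHn.
by move/(_ s); rewrite rot_iter// rot_size.
Qed.

(** [to_front k] rotates the first [k.+1] entries cyclically and fixes the others. Hence S6 is
    inverted by iterating it. *)
Lemma to_front_iter T k (s : seq T) : k < size s -> iter k.+1 (to_front k) s = s.
Proof.
move=> ltk.
have H m : iter m (to_front k) s = iter m (rotr 1) (take k.+1 s) ++ drop k.+1 s.
  elim: m => [|m IHm]; first by rewrite cat_take_drop.
  rewrite !iterS IHm /to_front.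
  have sz : size (iter m (rotr 1) (take k.+1 s)) = k.+1.
    by elim: m {IHm} => [|m IHm]; rewrite ?iterS ?size_rotr// size_takel.
  by rewrite take_size_cat// drop_size_cat.
by rewrite H -{1}(size_takel ltk) rotr1_iter cat_take_drop.
Qed.

Lemma to_front_onth T k (s : seq T) x : onth s k = Some x ->
  to_front k s = x :: take k s ++ drop k.+1 s.
Proof.
move=> sk; have ltk : k < size s by rewrite -onthTE sk.
by rewrite /to_front (take_nth x ltk) (@onth_nth T x x s k sk) rotr1_rcons.
Qed.

Lemma front_iter j k a : j < 4 -> k < nth 0 (sizes a) j -> iter k.+1 (front j k) a = a.
Proof.
have I0 m b : iter m (front 0 k) b =
    Args (iter m (to_front k) (args0 b)) (args1 b) (args2 b) (args3 b).
  by elim: m => [|m IHm]; [case: b | rewrite !iterS IHm].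
have I1 m b : iter m (front 1 k) b =
    Args (args0 b) (iter m (to_front k) (args1 b)) (args2 b) (args3 b).
  by elim: m => [|m IHm]; [case: b | rewrite !iterS IHm].
have I2 m b : iter m (front 2 k) b =
    Args (args0 b) (args1 b) (iter m (to_front k) (args2 b)) (args3 b).
  by elim: m => [|m IHm]; [case: b | rewrite !iterS IHm].
have I3 m b : iter m (front 3 k) b =
    Args (args0 b) (args1 b) (args2 b) (iter m (to_front k) (args3 b)).
  by elim: m => [|m IHm]; [case: b | rewrite !iterS IHm].
by case: j => [|[|[|[|j]]]]// _ ltk; rewrite (I0, I1, I2, I3) to_front_iter//; case: (a).
Qed.

Lemma kleene_front j k g a v : j < 4 -> k < nth 0 (sizes a) j ->
  kleene g (front j k a) v -> kleene ⟨[:: 6; signature a; j; k; g]⟩ a v.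
Proof.
case: j => [|[|[|[|j]]]]//= _; by [exact: S6_0|exact: S6_1|exact: S6_2|exact: S6_3].
Qed.

Lemma kleene_front_iter j k m sz g : j < 4 -> k < nth 0 sz j ->
  exists e, forall a v, sizes a = sz -> kleene g (iter m (front j k) a) v ->
    kleene e a v.
Proof.
move=> j4 ltk; elim: m => [|m [e He]]; first by exists g.
exists ⟨[:: 6; ⟨sz⟩; j; k; e]⟩ => a v sza H.
rewrite -sza; apply: kleene_front => //; first by rewrite sza.
by apply: He; [rewrite sizes_front | rewrite -iterSr].
Qed.

(** * Uniform computability over families of arguments *)

Record env (T : Type) := Env {
  ev :> T -> args;
  env_sizes : seq nat;
  ev_sizes : forall t, sizes (ev t) = env_sizes }.

Definition Comp T (E : env T) (P : T -> nat) :=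
  exists e, forall t, kleene e (E t) (P t).

(** Contexts grow as nested pairs: the newest variable is [p.2], at the head of its list of
    arguments, and older ones are reached through [p.1]. *)
Program Definition bind0 T (E : env T) : env (T * nat) :=
  @Env _ (fun p => add0 p.2 (E p.1)) (incr_nth (env_sizes E) 0) _.
Next Obligation. by move=> T E [t x]; rewrite -(ev_sizes E t). Qed.

Program Definition bind1 T (E : env T) : env (T * ftype1) :=
  @Env _ (fun p => add1 p.2 (E p.1)) (incr_nth (env_sizes E) 1) _.
Next Obligation. by move=> T E [t x]; rewrite -(ev_sizes E t). Qed.

Lemma eq_Comp T (E : env T) P Q : P =1 Q -> Comp E P -> Comp E Q.
Proof. by move=> /funext ->. Qed.

Lemma Comp_front T (E : env T) j k P : j < 4 -> k < nth 0 (env_sizes E) j ->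
  (exists e, forall t, kleene e (front j k (E t)) (P t)) -> Comp E P.
Proof.
move=> j4 ltk [g Hg]; have [e He] := kleene_front_iter 1 g j4 ltk.
by exists e => t; apply: He; [exact: ev_sizes | exact: Hg].
Qed.

(** S6 only brings entries to the front, but a suitable iterate puts them back. *)
Lemma Comp_unfront T (E : env T) j k P : j < 4 -> k < nth 0 (env_sizes E) j ->
  Comp E P -> exists e, forall t, kleene e (front j k (E t)) (P t).
Proof.
move=> j4 ltk [g Hg]; have [e He] := kleene_front_iter k g j4 ltk.
exists e => t; apply: He; first by rewrite sizes_front ev_sizes.
by rewrite -iterSr front_iter// ev_sizes.
Qed.

Lemma Comp_cst T (E : env T) q : Comp E (fun=> q).
Proof.
exists ⟨[:: 2; ⟨env_sizes E⟩; q]⟩ => t.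
by rewrite -(ev_sizes E t); exact: S2.
Qed.

Lemma Comp_hd T (E : env T) : Comp (bind0 E) snd.
Proof.
exists ⟨[:: 3; ⟨env_sizes (bind0 E)⟩]⟩ => t.
by rewrite -(ev_sizes (bind0 E) t); exact: S3.
Qed.

Lemma Comp_cut T (E : env T) x P :
  Comp E x -> Comp (bind0 E) P -> Comp E (fun t => P (t, x t)).
Proof.
move=> [h Hh] [g Hg]; exists ⟨[:: 4; ⟨env_sizes E⟩; g; h]⟩ => t.
rewrite -(ev_sizes E t); apply: S4; first exact: Hh.
exact: (Hg (t, x t)).
Qed.

Lemma signatureE a : signature a = ⟨sizes a⟩. Proof. by []. Qed.

(** S9 ignores trailing arguments; S6 brings the added argument [c] in front. *)
Lemma Comp_weak T T' (E : env T) (E' : env T') (g : T' -> T) (c : T' -> args) j k P :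
  j < 4 -> k < nth 0 (env_sizes E') j ->
  (forall t, front j k (cat_args (E (g t)) (c t)) = E' t) ->
  Comp E P -> Comp E' (fun t => P (g t)).
Proof.
move=> j4 ltk HE [e He].
pose sz := env_sizes E'.
have szc t : sizes (cat_args (E (g t)) (c t)) = sz.
  by rewrite /sz -(ev_sizes E' t) -HE sizes_front.
(* S4 and S2 supply the index [e] as the number argument that S9 runs; [k] further moves undo the
   single [front] of [HE]. *)
have [e' He'] := kleene_front_iter k
  ⟨[:: 4; ⟨sz⟩; ⟨[:: 9; ⟨incr_nth sz 0⟩; ⟨env_sizes E⟩]⟩; ⟨[:: 2; ⟨sz⟩; e]⟩]⟩ j4 ltk.
exists e' => t; apply: He'; first exact: ev_sizes.
rewrite -HE -iterSr front_iter ?szc// -(szc t) -signatureE.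
apply: (S4 (u := e)); first exact: S2.
rewrite -(ev_sizes E (g t)).
exact: (S9 (x := e) (c t) (He (g t))).
Qed.

Lemma to_front_cat1 T (s : seq T) x : to_front (size s) (s ++ [:: x]) = x :: s.
Proof.
by rewrite /to_front cats1 take_oversize ?drop_oversize ?size_rcons// cats0 rotr1_rcons.
Qed.

Lemma Comp_wk0 T (E : env T) P : Comp E P -> Comp (bind0 E) (fun p => P p.1).
Proof.
apply: (Comp_weak (c := fun p : T * nat => Args [:: p.2] [::] [::] [::])
  (j := 0) (k := nth 0 (env_sizes E) 0)) => //.
  by rewrite /= nth_incr_nth eqxx.
by move=> [t x]; rewrite -(ev_sizes E t) /= to_front_cat1 !cats0.
Qed.

Lemma Comp_wk1 T (E : env T) P : Comp E P -> Comp (bind1 E) (fun p => P p.1).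
Proof.
apply: (Comp_weak (c := fun p : T * ftype1 => Args [::] [:: p.2] [::] [::])
  (j := 1) (k := nth 0 (env_sizes E) 1)) => //.
  by rewrite /= nth_incr_nth eqxx.
by move=> [t x]; rewrite -(ev_sizes E t) /= to_front_cat1 !cats0.
Qed.

Lemma Comp_succ T (E : env T) x : Comp E x -> Comp E (fun t => (x t).+1).
Proof.
move=> cx; apply: (Comp_cut (P := fun p => p.2.+1) cx).
exists ⟨[:: 1; ⟨env_sizes (bind0 E)⟩]⟩ => t.
by rewrite -(ev_sizes (bind0 E) t); exact: S1.
Qed.

(** S5 runs its step on [add0 x (add0 u b)], so the counter is [p.2] and the previous value is
    [p.1.2]. *)
Lemma Comp_rec T (E : env T) g h n :
  Comp E g -> Comp (bind0 (bind0 E)) (fun p => h p.1.1 p.2 p.1.2) -> Comp E n ->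
  Comp E (fun t => nat_rect (fun=> nat) (g t) (h t) (n t)).
Proof.
move=> [eg Hg] [eh Hh] cn.
apply: (Comp_cut (P := fun p => nat_rect _ (g p.1) (h p.1) p.2) cn).
exists ⟨[:: 5; ⟨env_sizes (bind0 E)⟩; eg; eh]⟩ => -[t x].
rewrite -(ev_sizes (bind0 E) (t, x)) /=; elim: x => [|x IHx].
  by apply: S5_0; exact: Hg.
by apply: S5_S; [exact: IHx | exact: (Hh (t, _, x))].
Qed.

Definition Comp1 T (E : env T) (f : T -> ftype1) :=
  Comp (bind0 E) (fun p => f p.1 p.2).

Definition Comp2 T (E : env T) (F : T -> ftype2) :=
  Comp (bind1 E) (fun p => F p.1 p.2).

Lemma Comp1_hd T (E : env T) : Comp1 (bind1 E) snd.
Proof.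
exists ⟨[:: 7; ⟨env_sizes (bind0 (bind1 E))⟩]⟩ => -[[t f] x].
by rewrite -(ev_sizes (bind0 (bind1 E)) (t, f, x)); exact: S7.
Qed.

Lemma Comp_app1 T (E : env T) f x : Comp1 E f -> Comp E x -> Comp E (fun t => f t (x t)).
Proof. by move=> cf cx; exact: (Comp_cut cx cf). Qed.

(** S8 calls only functionals present among the arguments; a uniform index needs their position to
    be independent of [t]. *)
Definition var2 T (E : env T) (F : T -> ftype2) :=
  exists k, forall t, onth (args2 (E t)) k = Some (F t).

Definition var3 T (E : env T) (F : T -> ftype3) :=
  exists k, forall t, onth (args3 (E t)) k = Some (F t).

(** A member of [T] serves to read bounds on positions off an actual list of arguments; over an
    empty family any index works. *)
Lemma Comp_inhabited T (E : env T) P : (T -> Comp E P) -> Comp E P.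
Proof.
move=> H; have [[t]|nT] := pselect (inhabited T); first exact: H.
by exists 0 => t; case: nT; exists.
Qed.

(** S8 calls the first functional of its list, so [F] is moved there and the program for [f] is
    adapted to the new order by [Comp_unfront]. *)
Lemma Comp_var2 T (E : env T) (F : T -> ftype2) f :
  var2 E F -> Comp1 E f -> Comp E (fun t => F t (f t)).
Proof.
move=> [k HF] cf; apply: Comp_inhabited => t0.
have ltk : k < nth 0 (env_sizes E) 2.
  by rewrite -(ev_sizes E t0) /= -onthTE HF.
apply: (Comp_front (j := 2) _ ltk) => //.
have ltk' : k < nth 0 (env_sizes (bind0 E)) 2 by rewrite nth_incr_nth; exact: ltk.
have [h Hh] := Comp_unfront (isT : 2 < 4) ltk' cf.
exists ⟨[:: 8; ⟨env_sizes E⟩; 2; h]⟩ => t.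
rewrite -(ev_sizes E t) -(sizes_front 2 k).
have Hfr : front 2 k (E t) = add2 (F t) (Args (args0 (E t)) (args1 (E t))
   (take k (args2 (E t)) ++ drop k.+1 (args2 (E t))) (args3 (E t))).
  by rewrite /= (to_front_onth (HF t)).
rewrite Hfr; apply: S8_2 => x; have := Hh (t, x).
by rewrite /add2/= (to_front_onth (HF t)).
Qed.

Lemma Comp_var3 T (E : env T) (Psi : T -> ftype3) F v :
  var3 E Psi -> Comp2 E F -> (forall t, Psi t (F t) = Some (v t)) -> Comp E v.
Proof.
move=> [k HF] cf Hv; apply: Comp_inhabited => t0.
have ltk : k < nth 0 (env_sizes E) 3.
  by rewrite -(ev_sizes E t0) /= -onthTE HF.
apply: (Comp_front (j := 3) _ ltk) => //.
have ltk' : k < nth 0 (env_sizes (bind1 E)) 3 by rewrite nth_incr_nth; exact: ltk.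
have [h Hh] := Comp_unfront (isT : 3 < 4) ltk' cf.
exists ⟨[:: 8; ⟨env_sizes E⟩; 3; h]⟩ => t.
rewrite -(ev_sizes E t) -(sizes_front 3 k).
have Hfr : front 3 k (E t) = add3 (Psi t) (Args (args0 (E t)) (args1 (E t))
   (args2 (E t)) (take k (args3 (E t)) ++ drop k.+1 (args3 (E t)))).
  by rewrite /= (to_front_onth (HF t)).
rewrite Hfr; apply: (S8_3 (h := h) _ (Hv t)) => x; have := Hh (t, x).
by rewrite /add3/= (to_front_onth (HF t)).
Qed.

Lemma var2_bind0 T (E : env T) F : var2 E F -> var2 (bind0 E) (fun p => F p.1).
Proof. by move=> [k H]; exists k => -[t x]; exact: (H t). Qed.
Lemma var2_bind1 T (E : env T) F : var2 E F -> var2 (bind1 E) (fun p => F p.1).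
Proof. by move=> [k H]; exists k => -[t x]; exact: (H t). Qed.
Lemma var3_bind0 T (E : env T) F : var3 E F -> var3 (bind0 E) (fun p => F p.1).
Proof. by move=> [k H]; exists k => -[t x]; exact: (H t). Qed.
Lemma Comp_swap T (E : env T) P : Comp (bind0 (bind0 E)) P ->
  Comp (bind0 (bind0 E)) (fun p => P (p.1.1, p.2, p.1.2)).
Proof.
have s1 : 1 < nth 0 (env_sizes (bind0 (bind0 E))) 0.
  by rewrite /= !nth_incr_nth eqxx.
move=> [e He]; apply: (Comp_front (j := 0) _ s1) => //.
exists e => -[[t x] y]; have := He (t, y, x).
by rewrite /= /to_front /= take0 drop0.
Qed.

(** [Comp_wk0] adds the fresh variable after the bound one; the swap makes the bound one newest
    again. *)
Lemma Comp1_wk0 T (E : env T) f : Comp1 E f -> Comp1 (bind0 E) (fun p => f p.1).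
Proof. by move=> cf; exact: Comp_swap (Comp_wk0 cf). Qed.

(** * Primitive recursive arithmetic and decidable predicates *)

Lemma Comp_add T (E : env T) x y :
  Comp E x -> Comp E y -> Comp E (fun t => x t + y t).
Proof.
move=> cx cy.
have := Comp_rec (h := fun _ _ u => u.+1) cy
  (Comp_succ (Comp_wk0 (Comp_hd E))) cx.
by apply: eq_Comp => t; elim: (x t) => //= n ->.
Qed.

Lemma Comp_pred T (E : env T) x : Comp E x -> Comp E (fun t => (x t).-1).
Proof.
move=> cx.
have := Comp_rec (h := fun _ i _ => i) (Comp_cst E 0) (Comp_hd (bind0 E)) cx.
by apply: eq_Comp => t; case: (x t).
Qed.

Lemma Comp_sub T (E : env T) x y :
  Comp E x -> Comp E y -> Comp E (fun t => x t - y t).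
Proof.
move=> cx cy.
have := Comp_rec (h := fun _ _ u => u.-1) cx
  (Comp_pred (Comp_wk0 (Comp_hd E))) cy.
by apply: eq_Comp => t; elim: (y t) => /= [|n ->]; rewrite ?subn0 ?subnS.
Qed.

Lemma Comp_mul T (E : env T) x y :
  Comp E x -> Comp E y -> Comp E (fun t => x t * y t).
Proof.
move=> cx cy.
have := Comp_rec (h := fun t _ u => y t + u) (Comp_cst E 0)
  (Comp_add (Comp_wk0 (Comp_wk0 cy)) (Comp_wk0 (Comp_hd E))) cx.
by apply: eq_Comp => t; elim: (x t) => //= n ->.
Qed.

Lemma Comp_exp T (E : env T) x y :
  Comp E x -> Comp E y -> Comp E (fun t => x t ^ y t).
Proof.
move=> cx cy.
have := Comp_rec (h := fun t _ u => x t * u) (Comp_cst E 1)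
  (Comp_mul (Comp_wk0 (Comp_wk0 cx)) (Comp_wk0 (Comp_hd E))) cy.
by apply: eq_Comp => t; elim: (y t) => //= n ->; rewrite expnS.
Qed.

Definition Dec T (E : env T) (b : T -> bool) := Comp E (fun t => nat_of_bool (b t)).

Lemma eq_Dec T (E : env T) (b c : T -> bool) : b =1 c -> Dec E b -> Dec E c.
Proof. by move=> /funext ->. Qed.

Lemma Dec_leq T (E : env T) x y :
  Comp E x -> Comp E y -> Dec E (fun t => x t <= y t).
Proof.
move=> cx cy; have := Comp_sub (Comp_cst E 1) (Comp_sub cx cy).
by apply: eq_Comp => t; rewrite /leq; case: (x t - y t).
Qed.

Lemma Dec_not T (E : env T) b : Dec E b -> Dec E (fun t => ~~ b t).
Proof.
by move/(Comp_sub (Comp_cst E 1)); apply: eq_Comp => t; case: (b t).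
Qed.

Lemma Dec_and T (E : env T) b c : Dec E b -> Dec E c -> Dec E (fun t => b t && c t).
Proof.
by move=> cb /(Comp_mul cb); apply: eq_Comp => t; case: (b t) (c t) => -[].
Qed.

Lemma Dec_eq T (E : env T) x y :
  Comp E x -> Comp E y -> Dec E (fun t => x t == y t).
Proof.
move=> cx cy; have := Dec_and (Dec_leq cx cy) (Dec_leq cy cx).
by apply: eq_Dec => t; rewrite -eqn_leq.
Qed.

Lemma Comp_if T (E : env T) (b : T -> bool) x y : Dec E b -> Comp E x -> Comp E y ->
  Comp E (fun t => if b t then x t else y t).
Proof.
move=> cb cx cy; have := Comp_add (Comp_mul cb cx) (Comp_mul (Dec_not cb) cy).
by apply: eq_Comp => t; case: (b t); rewrite /= ?mul0n ?mul1n ?addn0.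
Qed.

(** Bounded search by primitive recursion: later hits overwrite earlier ones, and 0 is the
    default. *)
Definition last_below (P : pred nat) (n : nat) : nat :=
  nat_rect (fun=> nat) 0 (fun i u => if P i then i else u) n.

Lemma last_belowP (P : pred nat) n i : i < n -> P i ->
  (forall j, j < n -> P j -> j <= i) -> last_below P n = i.
Proof.
elim: n => //= n IHn; rewrite ltnS => lei Pi Hi.
case: (ltngtP i n) lei => // [lti|eqi] _; last by rewrite -eqi Pi.
case: ifP => [Pn|_]; first by have := Hi n (leqnn _) Pn; rewrite leqNgt lti.
by apply: IHn => // j ltj; apply: Hi; rewrite ltnW.
Qed.

Lemma Comp_last_below T (E : env T) (P : T -> pred nat) n :
  Dec (bind0 E) (fun p => P p.1 p.2) -> Comp E n ->
  Comp E (fun t => last_below (P t) (n t)).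
Proof.
move=> cP cn; apply: (Comp_rec (h := fun t i u => if P t i then i else u)) => //.
  exact: Comp_cst.
apply: Comp_if; first exact: (Comp1_wk0 (f := fun t i => nat_of_bool (P t i))).
  exact: Comp_hd.
exact: Comp_wk0 (Comp_hd _).
Qed.

Lemma Comp_divn T (E : env T) x y :
  Comp E x -> Comp E y -> (forall t, 0 < y t) -> Comp E (fun t => x t %/ y t).
Proof.
move=> cx cy y_gt0.
have : Comp E (fun t => last_below (fun q => q * y t <= x t) (x t).+1).
  apply: (Comp_last_below (P := fun t q => q * y t <= x t)); last exact: Comp_succ.
  by apply: Dec_leq; [apply: Comp_mul; [exact: Comp_hd|]|]; exact: Comp_wk0.
apply: eq_Comp => t; apply: last_belowP.
- by rewrite ltnS leq_div.
- exact: leq_trunc_div.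
- by move=> j _; rewrite leq_divRL.
Qed.

(** * Decoding finite sequences *)

Definition code_head n := nth 0 (CodeSeq.decode n) 0.
Definition code_tail n := CodeSeq.code (behead (CodeSeq.decode n)).

Lemma code_cons x s : ⟨x :: s⟩ = 2 ^ x * (⟨s⟩.*2.+1). Proof. by []. Qed.

(** By [code_cons] the head of a nonempty sequence is the exponent of 2 in its code, found as the
    last [i] such that [2 ^ i] divides the code. On the empty sequence, of code 0, the search
    returns its default 0. *)
Lemma Comp_code_head T (E : env T) x : Comp E x -> Comp E (fun t => code_head (x t)).
Proof.
move=> cx.
have : Comp E (fun t => last_below (fun i => x t %/ 2 ^ i * 2 ^ i == x t) (x t)).
  apply: (Comp_last_below (P := fun t i => x t %/ 2 ^ i * 2 ^ i == x t)) => //.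
  apply: Dec_eq; last exact: Comp_wk0.
  have c2 : Comp (bind0 E) (fun p => 2 ^ p.2).
    by apply: Comp_exp; [exact: Comp_cst | exact: Comp_hd].
  apply: Comp_mul => //; apply: Comp_divn => //; last by move=> p; rewrite expn_gt0.
  exact: Comp_wk0 cx.
apply: eq_Comp => t; rewrite -(CodeSeq.decodeK (x t)) /code_head CodeSeq.codeK.
case: (CodeSeq.decode (x t)) => [|i s] //=; apply: last_belowP.
- by rewrite (leq_trans (ltn_expl i (ltnSn 1)))// leq_pmulr.
- by rewrite divnK// dvdn_mulr.
- move=> j _ /eqP H; have : 2 ^ j %| 2 ^ i * ⟨s⟩.*2.+1 by rewrite -H dvdn_mull.
  rewrite Gauss_dvdl; first by rewrite dvdn_Pexp2l.
  by rewrite coprimeXl// coprime2n /= odd_double.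
Qed.

Lemma Comp_code_tail T (E : env T) x : Comp E x -> Comp E (fun t => code_tail (x t)).
Proof.
move=> cx; have : Comp E (fun t => x t %/ 2 ^ (code_head (x t)) %/ 2).
  apply: Comp_divn => //; last exact: Comp_cst.
  apply: Comp_divn => //; last by move=> t; rewrite expn_gt0.
  by apply: Comp_exp; [exact: Comp_cst | exact: Comp_code_head].
apply: eq_Comp => t; rewrite -(CodeSeq.decodeK (x t)) /code_tail /code_head CodeSeq.codeK.
case: (CodeSeq.decode (x t)) => [|i s] //=.
by rewrite mulKn ?expn_gt0// divn2 /= uphalf_double.
Qed.

Lemma nth_code_tail n i : nth 0 (CodeSeq.decode (code_tail n)) i = nth 0 (CodeSeq.decode n) i.+1.
Proof. by rewrite CodeSeq.codeK nth_behead. Qed.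

Lemma Comp_code_nth T (E : env T) x i :
  Comp E x -> Comp E (fun t => nth 0 (CodeSeq.decode (x t)) i).
Proof.
elim: i x => [|i IHi] x cx; first exact: Comp_code_head.
by have := IHi _ (Comp_code_tail cx); apply: eq_Comp => t; rewrite nth_code_tail.
Qed.

Lemma Comp_code_cons T (E : env T) x s :
  Comp E x -> Comp E (fun t => ⟨s t⟩) -> Comp E (fun t => ⟨x t :: s t⟩).
Proof.
move=> cx cs; have : Comp E (fun t => 2 ^ x t * (2 * ⟨s t⟩).+1).
  by apply: Comp_mul; [apply: Comp_exp | apply: Comp_succ; apply: Comp_mul];
    rewrite //; exact: Comp_cst.
by apply: eq_Comp => t; rewrite code_cons mul2n.
Qed.

(** * Number quantifiers from [exists_2] or [suslin] *)

Definition has_ex2 T (E : env T) :=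
  var2 E (fun=> exists_2) \/ var2 E (fun=> suslin).

Lemma has_ex2_bind0 T (E : env T) : has_ex2 E -> has_ex2 (bind0 E).
Proof. by case=> H; [left|right]; exact: (var2_bind0 H). Qed.

Lemma has_ex2_bind1 T (E : env T) : has_ex2 E -> has_ex2 (bind1 E).
Proof. by case=> H; [left|right]; exact: (var2_bind1 H). Qed.

Lemma code_cons_eq0 x s : (⟨x :: s⟩ == 0) = false.
Proof. by rewrite code_cons muln_eq0 expn_eq0. Qed.

(** On nonempty sequences the test reads only the first entry, so a branch exists iff [g] has a
    zero. The code 0 of the empty sequence is accepted because every branch passes through it. *)
Lemma suslin_exists_2 g :
  suslin (fun c => if c == 0 then 0 else g (code_head c)) = exists_2 g.
Proof.
rewrite /suslin /exists_2; congr (if _ then _ else _).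
apply: asbool_equiv_eq; split => [[h Hh]|[n gn]].
  exists (h 0); have := Hh 1; rewrite (_ : mkseq h 1 = [:: h 0])//.
  by rewrite code_cons_eq0 /code_head CodeSeq.codeK.
exists (fun=> n) => -[|k] //; rewrite -[mkseq _ _]/(n :: map _ (iota 1 k)).
by rewrite code_cons_eq0 /code_head CodeSeq.codeK.
Qed.

Lemma Comp_exists_2 T (E : env T) (g : T -> ftype1) :
  has_ex2 E -> Comp1 E g -> Comp E (fun t => exists_2 (g t)).
Proof.
move=> [] HE cg; first exact: (Comp_var2 HE cg).
suff cf : Comp1 E (fun t c => if c == 0 then 0 else g t (code_head c)).
  by have := Comp_var2 HE cf; apply: eq_Comp => t; exact: suslin_exists_2.
apply: Comp_if; first by apply: Dec_eq; [exact: Comp_hd | exact: Comp_cst].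
  exact: Comp_cst.
apply: (Comp_app1 (f := fun p => g p.1)); first exact: Comp1_wk0.
exact: Comp_code_head (Comp_hd _).
Qed.

Lemma Dec_ex T (E : env T) (P : T -> nat -> bool) : has_ex2 E ->
  Dec (bind0 E) (fun p => P p.1 p.2) -> Dec E (fun t => `[< exists n, P t n >]).
Proof.
move=> HE cP.
(* [exists_2] looks for a zero and signals success by 0, so truth values are flipped before and
   after the call. *)
have cf : Comp1 E (fun t n => 1 - P t n) by apply: Comp_sub => //; exact: Comp_cst.
have := Comp_sub (Comp_cst E 1) (Comp_exists_2 HE cf).
apply: eq_Comp => t; rewrite /exists_2.
rewrite (_ : `[< _ >] = `[< exists n, P t n >]); first by case: ifP.
by apply: asbool_equiv_eq; split=> -[n H]; exists n; move: H; case: (P t n).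
Qed.

Lemma Dec_all T (E : env T) (P : T -> nat -> bool) : has_ex2 E ->
  Dec (bind0 E) (fun p => P p.1 p.2) -> Dec E (fun t => `[< forall n, P t n >]).
Proof.
move=> HE cP; have := Dec_not (Dec_ex (P := fun t n => ~~ P t n) HE (Dec_not cP)).
apply: eq_Dec => t; rewrite -asbool_neg; apply: asbool_equiv_eq; split.
  by move=> H n; apply: contra_notT H => H; exists n.
by move=> H [n]; rewrite H.
Qed.

(** * Exact rational arithmetic *)

Local Open Scope ring_scope.

(** The shape of [ratval]: a difference of naturals allows both signs, and a successor keeps the
    denominator nonzero. *)
Definition CompQ (R : realType) T (E : env T) (q : T -> R) :=
  exists a b c : T -> nat, [/\ Comp E a, Comp E b, Comp E c &
    forall t, q t = ((a t)%:R - (b t)%:R) / (c t).+1%:R].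

Lemma CompQ_ratval (R : realType) T (E : env T) m :
  Comp E m -> CompQ E (fun t => ratval R (m t)).
Proof. 
move=> cm; pose a i t := nth 0%N (CodeSeq.decode (m t)) i.
by exists (a 0), (a 1), (a 2); split => //; exact: Comp_code_nth.
Qed.

Lemma CompQ_nat (R : realType) T (E : env T) m :
  Comp E m -> CompQ E (fun t => (m t)%:R : R).
Proof.
move=> cm; exists m, (fun=> 0%N), (fun=> 0%N).
by split=> //; try exact: Comp_cst; move=> t; rewrite subr0 divr1.
Qed.

Lemma CompQ_opp (R : realType) T (E : env T) (p : T -> R) :
  CompQ E p -> CompQ E (fun t => - p t).
Proof.
by move=> [a [b [c [ca cb cc Hp]]]]; exists b, a, c; split=> // t; rewrite Hp -mulNr opprB.
Qed.

Lemma CompQ_add (R : realType) T (E : env T) (p q : T -> R) :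
  CompQ E p -> CompQ E q -> CompQ E (fun t => p t + q t).
Proof.
move=> [a [b [c [ca cb cc Hp]]]] [a' [b' [c' [ca' cb' cc' Hq]]]].
exists (fun t => a t * (c' t).+1 + a' t * (c t).+1)%N,
  (fun t => b t * (c' t).+1 + b' t * (c t).+1)%N,
  (fun t => ((c t).+1 * (c' t).+1).-1)%N.
split; first by apply: Comp_add; apply: Comp_mul => //; exact: Comp_succ.
- by apply: Comp_add; apply: Comp_mul => //; exact: Comp_succ.
- by apply: Comp_pred; apply: Comp_mul => //; exact: Comp_succ.
- move=> t; rewrite Hp Hq prednK// !natrD !natrM.
  have : (c t).+1%:R != 0 :> R by rewrite pnatr_eq0.
  have : (c' t).+1%:R != 0 :> R by rewrite pnatr_eq0.
  by move: (c t).+1%:R (c' t).+1%:R => C C' C0 C'0; field; rewrite C0 C'0.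
Qed.

Lemma CompQ_sub (R : realType) T (E : env T) (p q : T -> R) :
  CompQ E p -> CompQ E q -> CompQ E (fun t => p t - q t).
Proof. by move=> cp /CompQ_opp; exact: CompQ_add. Qed.

Lemma CompQ_mul (R : realType) T (E : env T) (p q : T -> R) :
  CompQ E p -> CompQ E q -> CompQ E (fun t => p t * q t).
Proof.
move=> [a [b [c [ca cb cc Hp]]]] [a' [b' [c' [ca' cb' cc' Hq]]]].
exists (fun t => a t * a' t + b t * b' t)%N, (fun t => a t * b' t + b t * a' t)%N,
  (fun t => ((c t).+1 * (c' t).+1).-1)%N.
split; try by apply: Comp_add; apply: Comp_mul.
- by apply: Comp_pred; apply: Comp_mul => //; exact: Comp_succ.
- move=> t; rewrite Hp Hq prednK// !natrD !natrM.
  have : (c t).+1%:R != 0 :> R by rewrite pnatr_eq0.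
  have : (c' t).+1%:R != 0 :> R by rewrite pnatr_eq0.
  by move: (c t).+1%:R (c' t).+1%:R => C C' C0 C'0; field; rewrite C0 C'0.
Qed.

Lemma CompQ_expV (R : realType) T (E : env T) b n : (0 < b)%N -> Comp E n ->
  CompQ E (fun t => b%:R ^- n t : R).
Proof.
move=> b0 cn; exists (fun=> 1%N), (fun=> 0%N), (fun t => (b ^ n t).-1)%N.
split; try exact: Comp_cst.
  by apply: Comp_pred; apply: Comp_exp => //; exact: Comp_cst.
by move=> t; rewrite subr0 div1r prednK ?expn_gt0 ?b0// natrX.
Qed.

Lemma Dec_leQ (R : realType) T (E : env T) (p q : T -> R) :
  CompQ E p -> CompQ E q -> Dec E (fun t => p t <= q t).
Proof.
move=> cp cq; have [a [b [c [ca cb cc H]]]] := CompQ_sub cq cp.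
have := Dec_leq cb ca; apply: eq_Dec => t.
by rewrite -subr_ge0 H pmulr_lge0 ?invr_gt0 ?ltr0n// subr_ge0 ler_nat.
Qed.

Lemma Dec_ltQ (R : realType) T (E : env T) (p q : T -> R) :
  CompQ E p -> CompQ E q -> Dec E (fun t => p t < q t).
Proof.
by move=> cp cq; have := Dec_not (Dec_leQ cq cp); apply: eq_Dec => t; rewrite ltNge.
Qed.

Lemma ratval_code3 (R : realType) a b c :
  ratval R ⟨[:: a; b; c]⟩ = (a%:R - b%:R) / c.+1%:R.
Proof. by rewrite /ratval CodeSeq.codeK. Qed.

(** * Expansions in base [b] and lower semi-continuity *)

Local Open Scope classical_set_scope.

(** Horner's scheme: the integer whose base [b] digits are the first [n] bits of [z]. *)
Fixpoint digs (b : nat) (z : nat -> bool) (n : nat) : nat :=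
  if n is i.+1 then (b * digs b z i + z i)%N else 0%N.

Lemma eq_digs b (z w : nat -> bool) n : (forall i, (i < n)%N -> w i = z i) ->
  digs b w n = digs b z n.
Proof.
elim: n => //= n IHn H; rewrite IHn ?H// => i ltin; apply: H.
by rewrite ltnS ltnW.
Qed.

Section Reals.
Context {R : realType}.
Implicit Types (x y : R) (z w : nat -> bool) (f : R -> R).

Definition trunc (b : nat) z n : R := (digs b z n)%:R * b%:R ^- n.

(** The real with base [b] digits [z] after the point. Base 2 covers the unit interval; base 4
    leaves gaps that make the digits recoverable. *)
Definition emb (b : nat) z : R := sup (range (trunc b z)).

(** The geometric series of the [b ^- i.+1] for [i >= n]: what all remaining digits contribute if
    they are 1. *)
Definition tail (b n : nat) : R := b%:R ^- n / b.-1%:R.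

Lemma trunc_le_succ b z n : (1 < b)%N -> trunc b z n <= trunc b z n.+1.
Proof.
move=> b1; rewrite /trunc /= exprS invfM mulrA natrD natrM ler_pM2r.
  rewrite mulrDl mulrAC divff ?pnatr_eq0; last lia.
  by rewrite mul1r lerDl divr_ge0.
by rewrite invr_gt0 exprn_gt0// ltr0n; lia.
Qed.

Lemma trunc_tail_succ b z n : (1 < b)%N ->
  trunc b z n.+1 + tail b n.+1 <= trunc b z n + tail b n.
Proof.
move=> b1; rewrite /trunc /tail /= exprS invfM natrD natrM.
have b0 : b%:R != 0 :> R by rewrite pnatr_eq0; lia.
have b1' : b.-1%:R != 0 :> R by rewrite pnatr_eq0; lia.
have Hb : b%:R = b.-1%:R + 1 :> R by rewrite natr1 prednK//; lia.
have p0 : 0 < b%:R ^- n :> R by rewrite invr_gt0 exprn_gt0// ltr0n; lia.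
move: (b%:R ^- n) p0 => p p0.
(* Since [tail b n] is [b ^- n.+1 + tail b n.+1], the inequality reduces to the digit [z n] being at
   most 1. *)
have -> : (digs b z n)%:R * p + p / b.-1%:R =
  (b%:R * (digs b z n)%:R + 1) * (b%:R^-1 * p) + b%:R^-1 * p / b.-1%:R.
  by rewrite Hb; field; rewrite b1' -Hb b0.
rewrite lerD2r ler_pM2r; last by rewrite mulr_gt0// invr_gt0 ltr0n; lia.
by rewrite lerD2l lern1; case: (z n).
Qed.

(** The truncations increase and the upper bounds decrease, so the two are compared at the larger
    index. *)
Lemma trunc_le_tail b z m n : (1 < b)%N -> trunc b z m <= trunc b z n + tail b n.
Proof.
move=> b1.
have tail_ge0 k : 0 <= tail b k by rewrite /tail divr_ge0// invr_ge0 exprn_ge0.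
have [lemn|/ltnW lenm] := leqP m n.
  rewrite (@le_trans _ _ (trunc b z n)) ?lerDl//.
  apply: (homo_leq (f := trunc b z) (r := fun x y => x <= y)) lemn => //.
    by move=> ? ? ?; exact: le_trans.
  by move=> i; exact: trunc_le_succ.
rewrite (@le_trans _ _ (trunc b z m + tail b m)) ?lerDl//.
apply: (homo_leq (f := fun n => trunc b z n + tail b n) (r := fun x y => y <= x)) lenm => //.
  by move=> ? ? ? H /le_trans; exact.
by move=> i; exact: trunc_tail_succ.
Qed.

Lemma trunc_le_emb b z n : (1 < b)%N -> trunc b z n <= emb b z.
Proof.
move=> b1; apply: ub_le_sup; last by exists n.
by exists (trunc b z 0 + tail b 0) => _ [m _ <-]; exact: trunc_le_tail.
Qed.

Lemma emb_le_tail b z n : (1 < b)%N -> emb b z <= trunc b z n + tail b n.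
Proof.
move=> b1; apply: ge_sup; first by exists (trunc b z 0), 0%N.
by move=> _ [m _ <-]; exact: trunc_le_tail.
Qed.

Lemma tail_le b n : (1 < b)%N -> tail b n <= 2 ^- n.
Proof.
move=> b1; have p0 : 0 < b%:R ^- n :> R by rewrite invr_gt0 exprn_gt0// ltr0n; lia.
rewrite /tail (@le_trans _ _ (b%:R ^- n))//.
  have b1' : (0 < b.-1)%N by lia.
  by rewrite ler_pdivrMr ?ltr0n// ler_peMr ?ler1n// ltW.
rewrite lef_pV2 ?posrE ?exprn_gt0// ?ltr0n; last lia.
by apply: lerXn2r; rewrite ?nnegrE ?ler0n// ler_nat.
Qed.

Lemma emb_trunc b z n : (1 < b)%N -> `|trunc b z n - emb b z| <= 2 ^- n.
Proof.
move=> b1; have := trunc_le_emb z n b1; have := emb_le_tail z n b1.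
by have := tail_le n b1; rewrite ler_norml => *; apply/andP; split; lra.
Qed.

Lemma exp2V_gt0 n : 0 < 2 ^- n :> R.
Proof. by rewrite invr_gt0 exprn_gt0. Qed.

Lemma exists_exp2V_lt (e : R) : 0 < e -> exists n, 2 ^- n < e.
Proof.
move=> e0; exists (Num.bound e^-1).
rewrite invf_plt ?posrE ?exprn_gt0//.
rewrite (@lt_trans _ _ (Num.bound e^-1)%:R)//.
  by rewrite archi_boundP// invr_ge0 ltW.
by rewrite -natrX ltr_nat ltn_expl.
Qed.

Lemma le_of_exp2V x y (c : R) : 0 < c -> (forall n, x <= y + c * 2 ^- n) -> x <= y.
Proof.
move=> c0 H; rewrite leNgt; apply/negP => ltyx.
have [|n] := @exists_exp2V_lt ((x - y) / c); first by rewrite divr_gt0// subr_gt0.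
by rewrite ltr_pdivlMr// => Hn; have := H n; lra.
Qed.

Lemma eq_of_exp2V x y (c : R) : 0 < c -> (forall n, `|x - y| <= c * 2 ^- n) -> x = y.
Proof.
move=> c0 H; apply/eqP; rewrite eq_le; apply/andP; split.
  by apply: (le_of_exp2V c0) => n; have := H n; rewrite ler_norml => /andP[]; lra.
by apply: (le_of_exp2V c0) => n; have := H n; rewrite ler_norml => /andP[]; lra.
Qed.

Lemma emb_agree b z w n : (1 < b)%N -> (forall i, (i < n)%N -> w i = z i) ->
  `|emb b w - emb b z| <= 2 ^- n.
Proof.
move=> b1 /(@eq_digs b) H; have E : trunc b w n = trunc b z n by rewrite /trunc H.
have := trunc_le_emb z n b1; have := emb_le_tail z n b1.
have := trunc_le_emb w n b1; have := emb_le_tail w n b1.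
by have := tail_le n b1; rewrite E ler_norml => *; apply/andP; split; lra.
Qed.

Lemma emb_ge0 b z : (1 < b)%N -> 0 <= emb b z.
Proof. by move/(trunc_le_emb z 0); rewrite /trunc mul0r. Qed.

Lemma emb_le b z : (1 < b)%N -> emb b z <= b.-1%:R^-1.
Proof. by move/(emb_le_tail z 0); rewrite /trunc /tail mul0r add0r expr0 invr1 mul1r. Qed.

Lemma emb2_surj x : 0 <= x <= 1 -> exists z, emb 2 z = x.
Proof.
move=> x01.
(* Greedy binary expansion: [r n] is the remainder after [n] digits, rescaled by [2 ^ n]. The
   remainder 1 reproduces itself, which handles [x = 1]. *)
pose r n := iter n (fun y : R => 2 * y - (2^-1 <= y)%R%:R) x.
pose z n := 2^-1 <= r n.
have r01 n : 0 <= r n <= 1.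
  elim: n => [//|n]; rewrite /r iterS -/(r n); case: (leP 2^-1 (r n)) => /= H /andP[? ?].
    by apply/andP; split; lra.
  by apply/andP; split; lra.
have xE n : x = trunc 2 z n + 2 ^- n * r n.
  elim: n => [|n IHn]; first by rewrite /trunc mul0r add0r expr0 invr1 mul1r.
  rewrite [LHS]IHn /trunc [digs _ _ _]/= natrD natrM exprS invfM /r iterS -/(r n) -/(z n).
  by have : 2 ^+ n != 0 :> R by []; move: (2 ^+ n) => p p0; field.
exists z; apply: (@eq_of_exp2V _ _ 2) => // n.
have := emb_trunc z n (isT : (1 < 2)%N); have := xE n; have := r01 n.
have := exp2V_gt0 n; move: (2 ^- n) => p p0 /andP[r0 r1] xn.
have : p * r n <= p by rewrite ler_piMr// ltW.
have : 0 <= p * r n by rewrite mulr_ge0// ltW.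
by rewrite !ler_norml => ? ? /andP[? ?]; apply/andP; split; lra.
Qed.

Lemma ratval_ratr (q : rat) : exists n, ratval R n = ratr q.
Proof.
have [d dq] : exists d : nat, denq q = d.+1%:Z.
  by have := denq_gt0 q; case: (denq q) => // -[|d]// _; exists d.
rewrite /ratr dq; case: (numq q) => [m|m].
  by exists ⟨[:: m; 0; d]⟩%N; rewrite /ratval CodeSeq.codeK /= subr0.
exists ⟨[:: 0; m.+1; d]⟩%N; rewrite /ratval CodeSeq.codeK /=.
by rewrite NegzE mulrNz sub0r.
Qed.

Lemma ratval_dense x y : x < y -> exists n, x < ratval R n < y.
Proof.
move=> /rat_in_itvoo[q]; have [n <-] := ratval_ratr q.
by rewrite in_itv /= => H; exists n.
Qed.

(** * Lower semi-continuity in terms of epsilon and delta *)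

Definition lsc01_eps f := forall x0, 0 <= x0 <= 1 -> forall e, 0 < e ->
  exists2 d, 0 < d & forall x, 0 <= x <= 1 -> `|x - x0| < d -> f x0 - e < f x.

(** [limf_einf] of [f] is minus [limf_esup] of [- f], an infimum of suprema over punctured
    neighbourhoods; at the missing point [x0] the bound is immediate. *)
Lemma lsc01P f : lsc01 f <-> lsc01_eps f.
Proof.
split=> H x0 x01.
  move=> e e0; have := H x0; rewrite in_itv /= => /(_ x01).
  rewrite /limf_einf leeNr => Hinf.
  have : (limf_esup (\- (fun x => (f x)%:E)) (within `[0%R, 1%R] x0^') < (- f x0 + e)%:E)%E.
    by rewrite (le_lt_trans Hinf)// -EFinN lte_fin ltrDl.
  rewrite /limf_esup => /ereal_inf_lt[_ [V HV <-] Vlt].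
  have [d /= d0 Hd] := HV.
  exists d => // x x_01 xd; have [->|xx0] := eqVneq x x0; first by rewrite ltrBlDr ltrDl.
  have Vx : V x.
    apply: Hd => //=; first by rewrite distrC.
  have : (- (f x)%:E < (- f x0 + e)%:E)%E.
    by apply: le_lt_trans Vlt; apply: ereal_sup_ubound; exists x.
  by rewrite -EFinN lte_fin; lra.
rewrite /limf_einf leeNr.
apply/lee_addgt0Pr => e e0.
have [d d0 Hd] := H x0 x01 e e0.
apply: (@le_trans _ _ (ereal_sup ((\- (fun x => (f x)%:E))%E @`
    [set x | 0 <= x <= 1 /\ `|x - x0| < d]))).
  apply: ereal_inf_lbound; eexists; last by [].
  exists d => //= x; rewrite /ball /= => xd xx0; rewrite in_itv /= => x_01.
  by rewrite distrC.
apply: ge_ereal_sup => _ [x [x_01 xd] <-].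
by rewrite -!EFinN -EFinD lee_fin; have := Hd x x_01 xd; lra.
Qed.
End Reals.

(** * Cylinders in Cantor space *)

Lemma nbhs_cylinder (z : cantor_space) n :
  nbhs z [set w : cantor_space | forall i, (i < n)%N -> w i = z i].
Proof.
elim: n => [|n IHn]; first by apply: filterS filterT => w _ i.
have Hn : nbhs z [set w : cantor_space | w n = z n].
  have := @proj_continuous nat (fun=> bool) n z.
  by move=> /(_ [set z n]); apply; exact: discrete_set1.
apply: filterS2 IHn Hn => w IH Hw i; rewrite ltnS leq_eqVlt => /orP[/eqP->//|].
exact: IH.
Qed.

Lemma closed_cylinder (A : set cantor_space) :
  (forall z, (forall n, exists2 w, A w & forall i, (i < n)%N -> w i = z i) -> A z) ->
  closed A.
Proof.
move=> H z clz; apply: H => n.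
by have [w [Aw Hw]] := clz _ (nbhs_cylinder z n); exists w.
Qed.

Section Continuity.
Context {R : realType}.
Implicit Types (x y : R) (f : R -> R).

Lemma emb_continuous b : (1 < b)%N -> continuous (emb b : cantor_space -> R).
Proof.
move=> b1 z; apply/cvgrPdist_lt => e e0.
have [n Hn] := exists_exp2V_lt e0.
apply: filterS (nbhs_cylinder z n) => w Hw.
by rewrite distrC (le_lt_trans (emb_agree b1 Hw)).
Qed.

Lemma continuous01P f : {within `[0, 1], continuous f} <->
  forall x0, 0 <= x0 <= 1 -> forall e, 0 < e ->
  exists2 d, 0 < d & forall x, 0 <= x <= 1 -> `|x - x0| < d -> `|f x - f x0| < e.
Proof.
split => [/subspace_continuousP cf x0 x01 e e0|H].
  have /cf/cvgrPdist_lt/(_ _ e0)[d /= d0 Hd] : `[0, 1]%classic x0 by rewrite /= in_itv.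
  exists d => // x x_01 xd; rewrite distrC; apply: Hd => /=; first by rewrite distrC.
  by rewrite in_itv.
apply/subspace_continuousP => x0; rewrite /= in_itv /= => x01.
apply/cvgrPdist_lt => e e0; have [d d0 Hd] := H x0 x01 e e0.
exists d => //= x; rewrite /ball /= => xd; rewrite in_itv /= => x_01.
by rewrite distrC; apply: Hd => //; rewrite distrC.
Qed.

(** Membership in the closure of the rational points of [f > q], phrased with number quantifiers
    only. *)
Definition adherent f (q x : R) := forall n, exists r : nat,
  [/\ 0 <= ratval R r <= 1, `|x - ratval R r| <= 2 ^- n & q < f (ratval R r)].

(** A lower semi-continuous function can only jump downwards, and a jump at [x]
    from above [q] is visible on the rationals since [f > q] is open. *)
Lemma discontinuousP f : lsc01 f ->
  (~ {within `[0, 1], continuous f}) <->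
  exists p q : nat, ratval R p < ratval R q /\
    exists x, [/\ 0 <= x <= 1, f x <= ratval R p & adherent f (ratval R q) x].
Proof.
move/lsc01P => lf; split; last first.
  move=> [p [q [pq [x [x01 fxp Hq]]]]] /continuous01P cf.
  have [|d d0 Hd] := cf x x01 (ratval R q - ratval R p); first by rewrite subr_gt0.
  have [n nd] := exists_exp2V_lt d0.
  have [r [r01 xr fr]] := Hq n.
  have := Hd _ r01; rewrite distrC (le_lt_trans xr nd) => /(_ isT).
  by rewrite ltr_norml => /andP[]; lra.
move=> /continuous01P; apply: contra_notP => NH x0 x01 e e0.
apply: contrapT => Hd.
have [d1 d10 Hd1] := lf x0 x01 e e0.
(* Near [x0] values at or below [f x0 - e] are excluded by lower semi-continuity, so a failure of
   continuity must be upward. *)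
have up d : 0 < d -> exists2 x, 0 <= x <= 1 & `|x - x0| < d /\ f x0 + e <= f x.
  move=> d0; apply: contrapT => H; apply: Hd; exists (Num.min d1 d).
    by rewrite lt_min d10.
  move=> x x_01; rewrite lt_min => /andP[xd1 xd].
  have H1 := Hd1 x x_01 xd1.
  have H2 : f x < f x0 + e by rewrite ltNge; apply/negP => H2; apply: H; exists x.
  by rewrite ltr_norml; apply/andP; split; lra.
apply: NH.
have [p /andP[p1 p2]] : exists p, f x0 < ratval R p < f x0 + e / 2.
  by apply: ratval_dense; rewrite ltrDl divr_gt0.
have [q /andP[q1 q2]] : exists p, f x0 + e / 2 < ratval R p < f x0 + e.
  by apply: ratval_dense; lra.
exists p, q; split; first exact: lt_trans p2 q1.
exists x0; split => //; first exact: ltW.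
(* Half of the tolerance leads from [x0] to a point [x] with [f x] above [ratval R q], the other
   half from [x] to a rational point. *)
move=> n; have h0 : 0 < 2 ^- n / 2 :> R by rewrite divr_gt0// exp2V_gt0.
have [x x_01 [xx0 fx]] := up _ h0.
have [|d d0 Hd'] := lf x x_01 (f x - ratval R q); first by rewrite subr_gt0; lra.
pose h := Num.min d (2 ^- n / 2).
have h_gt0 : 0 < h by rewrite lt_min d0.
have [r [r01 xr]] : exists r, 0 <= ratval R r <= 1 /\ `|ratval R r - x| < h.
  (* Cut down to the unit interval, the neighbourhood stays nonempty even if [x] is an endpoint. *)
  have /ratval_dense[r] : Num.max 0 (x - h) < Num.min 1 (x + h).
    by rewrite lt_min !gt_max; apply/andP; split; apply/andP; split; lra.
  rewrite gt_max lt_min => /andP[/andP[? ?] /andP[? ?]]; exists r.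
  by rewrite ltr_norml; split; apply/andP; split; lra.
exists r; split => //.
  move: xr xx0; rewrite lt_min ler_norml !ltr_norml.
  by move=> /andP[_ /andP[? ?]] /andP[? ?]; apply/andP; split; lra.
by have := Hd' _ r01; move: xr; rewrite lt_min => /andP[-> _] /(_ isT); lra.
Qed.

(** Sublevel sets of a lower semi-continuous function are closed, as is the set of adherent points.
    Both are tested on cylinders, where [emb 2] varies by at most [2 ^- n]. *)
Lemma closed_level_adherent f (p q : R) : lsc01 f ->
  closed [set z : cantor_space | f (emb 2 z) <= p /\ adherent f q (emb 2 z)].
Proof.
move/lsc01P => lf; apply: closed_cylinder => z Hz.
have emb01 w : 0 <= (emb 2 w : R) <= 1.
  by rewrite emb_ge0//= (le_trans (emb_le _ _))//= invr1.
split.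
  rewrite leNgt; apply/negP => ltp.
  have [|d d0 Hd] := lf _ (emb01 z) (f (emb 2 z) - p); first by rewrite subr_gt0.
  have [n nd] := exists_exp2V_lt d0.
  have [w [fw _] wz] := Hz n.
  have := Hd _ (emb01 w).
  by rewrite (le_lt_trans (emb_agree (isT : (1 < 2)%N) wz) nd) => /(_ isT); lra.
move=> n; have [w [_ /(_ n.+1)[r [r01 wr fr]]] wz] := Hz n.+1.
exists r; split => //.
have := @emb_agree R 2 z w _ isT wz; move: wr.
have -> : 2 ^- n = 2 ^- n.+1 + 2 ^- n.+1 :> R.
  by rewrite exprS invfM; field.
by rewrite !ler_norml => /andP[? ?] /andP[? ?]; apply/andP; split; lra.
Qed.

End Continuity.

(** * Deciding continuity with [Omega_C] *)

Lemma Comp1_fcons T (E : env T) n a :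
  Comp E n -> Comp1 E a -> Comp1 E (fun t => fcons (n t) (a t)).
Proof.
move=> cn ca.
have : Comp (bind0 E) (fun p => if p.2 == 0%N then n p.1 else a p.1 p.2.-1).
  apply: Comp_if; first by apply: Dec_eq; [exact: Comp_hd | exact: Comp_cst].
    exact: Comp_wk0.
  apply: (Comp_app1 (f := fun p => a p.1)); first exact: Comp1_wk0.
  exact: Comp_pred (Comp_hd _).
by apply: eq_Comp => -[t [|k]].
Qed.

Lemma Comp_digs T (E : env T) b (z : T -> nat -> bool) n :
  Dec (bind0 E) (fun p => z p.1 p.2) -> Comp E n -> Comp E (fun t => digs b (z t) (n t)).
Proof.
move=> cz cn.
have ch : Comp (bind0 (bind0 E)) (fun p => b * p.1.2 + z p.1.1 p.2)%N.
  apply: Comp_add; last exact: (Comp1_wk0 (f := fun t i => nat_of_bool (z t i))).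
  by apply: Comp_mul; [exact: Comp_cst | exact: Comp_wk0 (Comp_hd _)].
have := Comp_rec (h := fun t i u => (b * u + z t i)%N) (Comp_cst E 0) ch cn.
by apply: eq_Comp => t; elim: (n t) => //= k ->.
Qed.

Section ContinuityDecider.
Context {R : realType}.

Lemma CompQ_trunc T (E : env T) b (z : T -> nat -> bool) n : (0 < b)%N ->
  Dec (bind0 E) (fun p => z p.1 p.2) -> Comp E n ->
  CompQ E (fun t => trunc b (z t) (n t) : R).
Proof.
move=> b0 cz cn; apply: CompQ_mul; last exact: CompQ_expV.
by apply: CompQ_nat; exact: Comp_digs.
Qed.

Lemma CompQ_entry T (E : env T) (F : T -> ftype2) n a :
  var2 E F -> Comp E n -> Comp1 E a ->
  CompQ E (fun t => ratval R (F t (fcons (n t) (a t)))).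
Proof.
by move=> vF cn ca; apply: CompQ_ratval; apply: Comp_var2 => //; exact: Comp1_fcons.
Qed.

Lemma Dec_distQ T (E : env T) (p q r : T -> R) :
  CompQ E p -> CompQ E q -> CompQ E r -> Dec E (fun t => `|p t - q t| <= r t).
Proof.
move=> cp cq cr; have cd := CompQ_sub cp cq.
have := Dec_and (Dec_leQ (CompQ_opp cr) cd) (Dec_leQ cd cr).
by apply: eq_Dec => t; rewrite ler_norml.
Qed.

(** A left inverse of [bits], extended to all sequences because a type 2 functional must be
    total. *)
Definition bitsof (a : ftype1) : nat -> bool := fun i => a i == 1%N.

Lemma bitsK (z : cantor_space) : bitsof (bits z) = z.
Proof. by apply: funext => i; rewrite /bitsof /bits; case: (z i). Qed.

(** [ratval] adds 1 to its third entry, hence the predecessor of the denominator [2 ^ n]. *)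
Definition trunc_name (z : nat -> bool) : ftype1 :=
  fun n => ⟨[:: digs 2 z n; 0; (2 ^ n).-1]⟩%N.

Lemma ratval_trunc_name z n : ratval R (trunc_name z n) = trunc 2 z n.
Proof. by rewrite ratval_code3 subr0 prednK ?expn_gt0// natrX. Qed.

Lemma trunc_nameP z : real_name (trunc_name z) (emb 2 z : R).
Proof. by move=> n; rewrite ratval_trunc_name emb_trunc. Qed.

Definition le_at (F : ftype2) (a : ftype1) (p : R) : bool :=
  `[< forall n, ratval R (F (fcons n a)) <= p + 2 ^- n >].

(** Each approximation is within [2 ^- n] of [f x], so the tests give [f x <= p + 2 * 2 ^- n] for
    all [n], and conversely hold once [f x <= p]. *)
Lemma le_atP F f a (x p : R) : represents F f -> 0 <= x <= 1 -> real_name a x ->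
  le_at F a p = (f x <= p).
Proof.
move=> Ff x01 ax; have := Ff a x; rewrite in_itv /= => /(_ x01 ax) H.
apply/asboolP/idP => [Hp|fp n].
  apply: (@le_of_exp2V _ _ _ 2) => // n; have := Hp n; have := H n.
  by rewrite ler_norml => /andP[]; lra.
by have := H n; rewrite ler_norml => /andP[]; lra.
Qed.

(** The arithmetical form of the level set: [emb 2 z] is replaced by its truncations at the price of
    a doubled tolerance, and a rational is named by a constant sequence. *)
Definition in_level (F : ftype2) (p q : R) (z : nat -> bool) : bool :=
  le_at F (trunc_name z) p &&
  `[< forall n, `[< exists r, [&& 0 <= ratval R r, ratval R r <= 1,
      `|trunc 2 z n - ratval R r| <= 2 ^- n + 2 ^- n & ~~ le_at F (fun=> r) q] >] >].

Lemma in_levelP F (f : R -> R) p q z : represents F f ->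
  in_level F p q z = `[< f (emb 2 z) <= p /\ adherent f q (emb 2 z) >].
Proof.
move=> Ff; have emb01 : 0 <= (emb 2 z : R) <= 1.
  by rewrite emb_ge0//= (le_trans (emb_le _ _))//= invr1.
have cst_name r : real_name (fun=> r) (ratval R r).
  by move=> n; rewrite subrr normr0 ltW// exp2V_gt0.
have tz n : `|trunc 2 z n - emb 2 z| <= 2 ^- n :> R by exact: emb_trunc.
rewrite /in_level (le_atP p Ff emb01 (trunc_nameP z)).
apply/andP/asboolP => -[-> H]; split => //.
  (* At index [n.+2] the three errors add up to three quarters of [2 ^- n]. *)
  move=> n; move/asboolP/(_ n.+2)/asboolP: H => [r /and4P[r0 r1 tr fr]].
  have r01 : 0 <= ratval R r <= 1 by rewrite r0.
  exists r; split => //; last first.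
    by rewrite ltNge -(le_atP q Ff r01 (cst_name r)).
  move: tr (tz n.+2); rewrite !exprS !invfM; have := exp2V_gt0 (R := R) n.
  move: (2 ^- n) => e e0; rewrite !ler_norml => /andP[? ?] /andP[? ?].
  by apply/andP; split; lra.
apply/asboolP => n; apply/asboolP; have [r [r01 xr fr]] := H n; exists r.
rewrite (le_atP q Ff r01 (cst_name r)) -ltNge fr andbT.
case/andP: r01 => -> ->; move: xr (tz n); rewrite !ler_norml /=.
by move=> /andP[? ?] /andP[? ?]; apply/andP; split; lra.
Qed.

Lemma CompQ_wk0 T (E : env T) (p : T -> R) :
  CompQ E p -> CompQ (bind0 E) (fun t => p t.1).
Proof.
move=> [a [b [c [ca cb cc H]]]].
exists (fun t => a t.1), (fun t => b t.1), (fun t => c t.1).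
by split; try exact: Comp_wk0; move=> t; exact: H.
Qed.

Lemma Dec_le_at T (E : env T) (F : T -> ftype2) a (p : T -> R) : has_ex2 E ->
  var2 E F -> Comp1 E a -> CompQ E p -> Dec E (fun t => le_at (F t) (a t) (p t)).
Proof.
move=> HE vF ca cp.
apply: (Dec_all (P := fun t n => ratval R (F t (fcons n (a t))) <= p t + 2 ^- n)) => //.
apply: Dec_leQ; last by apply: CompQ_add; [exact: CompQ_wk0 | exact: CompQ_expV (Comp_hd _)].
apply: (CompQ_entry (F := fun p => F p.1) (a := fun p => a p.1)).
- exact: var2_bind0.
- exact: Comp_hd.
- exact: Comp1_wk0.
Qed.

Lemma Comp1_trunc_name T (E : env T) (z : T -> nat -> bool) :
  Dec (bind0 E) (fun p => z p.1 p.2) -> Comp1 E (fun t => trunc_name (z t)).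
Proof.
move=> cz; apply: Comp_code_cons.
  apply: Comp_digs (Comp_hd _).
  exact: (Comp1_wk0 (f := fun t i => nat_of_bool (z t i))).
apply: Comp_code_cons; first exact: Comp_cst.
apply: Comp_code_cons; last exact: Comp_cst.
by apply: Comp_pred; apply: Comp_exp; [exact: Comp_cst | exact: Comp_hd].
Qed.

Lemma Dec_in_level T (E : env T) (F : T -> ftype2) (p q : T -> R) z : has_ex2 E ->
  var2 E F -> CompQ E p -> CompQ E q -> Dec (bind0 E) (fun t => z t.1 t.2) ->
  Dec E (fun t => in_level (F t) (p t) (q t) (z t)).
Proof.
move=> HE vF cp cq cz; apply: Dec_and; first exact/Dec_le_at/cp/Comp1_trunc_name.
have HE' := has_ex2_bind0 HE.
have cr : Comp (bind0 (bind0 E)) snd by exact: Comp_hd.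
have cn : Comp (bind0 (bind0 E)) (fun t => t.1.2) by exact: Comp_wk0 (Comp_hd _).
have c2n := CompQ_expV R (isT : (0 < 2)%N) cn.
apply: (Dec_all (P := fun t n => `[< exists r, [&& 0 <= ratval R r, ratval R r <= 1,
  `|trunc 2 (z t) n - ratval R r| <= 2 ^- n + 2 ^- n & ~~ le_at (F t) (fun=> r) (q t)] >])) => //.
apply: (Dec_ex (P := fun t r => [&& 0 <= ratval R r, ratval R r <= 1,
  `|trunc 2 (z t.1) t.2 - ratval R r| <= 2 ^- t.2 + 2 ^- t.2 &
  ~~ le_at (F t.1) (fun=> r) (q t.1)])) => //.
have cvr := CompQ_ratval R cr.
apply: Dec_and; first by apply: Dec_leQ => //; exact: CompQ_nat (Comp_cst _ 0).
apply: Dec_and; first by apply: Dec_leQ => //; exact: CompQ_nat (Comp_cst _ 1).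
apply: Dec_and.
  apply: Dec_distQ => //; last exact: CompQ_add.
  apply: (CompQ_trunc (z := fun t => z t.1.1)) => //.
  apply: (Comp1_wk0 (f := fun t i => nat_of_bool (z t.1 i))).
  exact: (Comp1_wk0 (f := fun t i => nat_of_bool (z t i))).
apply: Dec_not.
apply: (Dec_le_at (F := fun t => F t.1.1) (a := fun t _ => t.2) (p := fun t => q t.1.1)).
- exact: has_ex2_bind0.
- exact: var2_bind0 (var2_bind0 vF).
- exact: Comp_wk0 cr.
- exact: CompQ_wk0 (CompQ_wk0 cq).
Qed.

(** * The decider and its correctness *)

Definition level_char (F : ftype2) (p q : nat) : ftype2 :=
  fun a => nat_of_bool (in_level F (ratval R p) (ratval R q) (bitsof a)).

(** The answer of [Omega_C] on the level set, defined for every [F] so that [discontinuity] is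
    total; see [Omega_C_level] for the agreement. *)
Definition level_value F p q : nat :=
  if `[< cantor_set (level_char F p q) = set0 >] then 0%N else 1%N.

Definition discontinuity (F : ftype2) : bool :=
  `[< exists p, `[< exists q,
    (ratval R p < ratval R q) && (level_value F p q == 1%N) >] >].

Lemma cantor_level F (f : R -> R) p q : represents F f -> cantor_set (level_char F p q) =
  [set z | f (emb 2 z) <= ratval R p /\ adherent f (ratval R q) (emb 2 z)].
Proof.
move=> Ff; apply/seteqP; split=> z; rewrite /cantor_set /= /level_char bitsK
  (in_levelP _ _ _ Ff).
  by case: asboolP.
by move=> /asboolP ->.
Qed.

Lemma Omega_C_level F (f : R -> R) p q : represents F f -> lsc01 f ->
  Omega_C (level_char F p q) = Some (level_value F p q).
Proof.
move=> Ff lf; rewrite /Omega_C asboolT//; split.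
  by move=> z; exact: leq_b1.
by rewrite (cantor_level _ _ Ff); exact: closed_level_adherent.
Qed.

Lemma discontinuityP F (f : R -> R) : represents F f -> lsc01 f ->
  discontinuity F = ~~ `[< {within `[0, 1], continuous f} >].
Proof.
move=> Ff lf; rewrite -asbool_neg; apply: asbool_equiv_eq.
apply: iff_trans (iff_sym (discontinuousP lf)); split.
  move=> [p /asboolP[q /andP[pq]]]; exists p, q; split => //; move: b.
  rewrite /level_value; case: asboolP => // + _.
  rewrite (cantor_level _ _ Ff) => /eqP/set0P[z [fz az]].
  by exists (emb 2 z); rewrite emb_ge0//= (le_trans (emb_le _ _))//= invr1.
move=> [p [q [pq [x [x01 fx ax]]]]]; exists p; apply/asboolP; exists q.
rewrite pq /level_value; case: asboolP => //; rewrite (cantor_level _ _ Ff).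
(* A witness in the unit interval is pulled back to Cantor space through a binary expansion. *)
have [z zx] := emb2_surj x01.
by move/seteqP => [/(_ z)]; rewrite /= zx => H _; case: H.
Qed.

(** Undefined off the specified inputs, where level sets may fail to be closed and [Omega_C] may be
    undefined on them. *)
Definition continuity_decider : ftype3 := fun F =>
  if `[< exists f : R -> R, represents F f /\ lsc01 f >]
  then Some (nat_of_bool (~~ discontinuity F)) else None.

Lemma continuity_deciderP : decides_continuity_of_lsc R continuity_decider.
Proof.
move=> F f Ff lf; rewrite /continuity_decider asboolT; last by exists f.
by rewrite (discontinuityP Ff lf) negbK; case: asboolP.
Qed.

Lemma computes_continuity_decider : computes Omega_C suslin continuity_decider.
Proof.
(* Over this family every call to [Omega_C] is defined, as [Comp_var3] demands. *)
pose T := {F : ftype2 | exists f : R -> R, represents F f /\ lsc01 f}.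
pose E := @Env T (fun t => Args [::] [::] [:: suslin; sval t] [:: Omega_C])
  [:: 0; 0; 2; 1]%N (fun=> erefl).
have HE : has_ex2 E by right; exists 0%N.
have vF : var2 E sval by exists 1%N.
have vO : var3 E (fun=> Omega_C) by exists 0%N.
suff [e He] : Dec E (fun t => ~~ discontinuity (sval t)).
  exists e => F v; rewrite /continuity_decider; case: asboolP => // HF [<-].
  exact: (He (exist _ F HF)).
apply: Dec_not.
apply: (Dec_ex (P := fun t p => `[< exists q,
    (ratval R p < ratval R q) && (level_value (sval t) p q == 1%N) >])) => //.
apply: (Dec_ex (P := fun t q => (ratval R t.2 < ratval R q) &&
  (level_value (sval t.1) t.2 q == 1%N))); first exact: has_ex2_bind0.
have cq : Comp (bind0 (bind0 E)) snd by exact: Comp_hd.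
have cp : Comp (bind0 (bind0 E)) (fun t => t.1.2) by exact: Comp_wk0 (Comp_hd _).
apply: Dec_and; first by apply: Dec_ltQ; exact: CompQ_ratval.
apply: Dec_eq; last exact: Comp_cst.
apply: (Comp_var3 (Psi := fun=> Omega_C)
  (F := fun t => level_char (sval t.1.1) t.1.2 t.2)).
- exact: (var3_bind0 (var3_bind0 vO)).
- apply: (Dec_in_level (F := fun t => sval t.1.1.1) (p := fun t => ratval R t.1.1.2)
    (q := fun t => ratval R t.1.2) (z := fun t => bitsof t.2)).
  + by apply: has_ex2_bind1; do 2 apply: has_ex2_bind0.
  + exact: (var2_bind1 (var2_bind0 (var2_bind0 vF))).
  + exact/CompQ_ratval/(Comp_wk1 cp).
  + exact/CompQ_ratval/(Comp_wk1 cq).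
  + by apply: Dec_eq; [exact: Comp1_hd | exact: Comp_cst].
- by move=> [[[F [f [Ff lf]]] p] q]; exact: Omega_C_level Ff lf.
Qed.

End ContinuityDecider.

(** * Computing [Omega_C] *)

Section Converse.
Context {R : realType}.

(** The digit of [x] of index [n] in base 4, when the remaining digits are 0 or 1. *)
Definition digit4 (a : ftype1) (n : nat) : bool :=
  `[< exists N : nat, [&& odd N,
    `[< forall k, N%:R * 4 ^- n.+1 <= ratval R (a k) + 2 ^- k >] &
    `[< forall k, ratval R (a k) <= N%:R * 4 ^- n.+1 + 4 ^- n.+1 * 2 ^- 1 + 2 ^- k >]] >].

Lemma name_leP a (x q : R) : real_name a x ->
  (forall k, ratval R (a k) <= q + 2 ^- k) <-> x <= q.
Proof.
move=> ax; split=> [H|xq k].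
  apply: (@le_of_exp2V _ _ _ 2) => // k; have := H k; have := ax k.
  by rewrite ler_norml => /andP[]; lra.
by have := ax k; rewrite ler_norml => /andP[]; lra.
Qed.

Lemma name_geP a (x q : R) : real_name a x ->
  (forall k, q <= ratval R (a k) + 2 ^- k) <-> q <= x.
Proof.
move=> ax; split=> [H|xq k].
  apply: (@le_of_exp2V _ _ _ 2) => // k; have := H k; have := ax k.
  by rewrite ler_norml => /andP[]; lra.
by have := ax k; rewrite ler_norml => /andP[]; lra.
Qed.

(** The real exceeds its truncation by at most a third of [4 ^- n.+1], within the half allowed by
    the test. Both are less than one unit, so [N] can only be [digs 4 z n.+1], whose parity is the
    digit [z n]. *)
Lemma digit4_emb a z : real_name a (emb 4 z : R) -> digit4 a = z.
Proof.
move=> ax; apply: funext => n; set x : R := emb 4 z in ax.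
have p0 : 0 < 4 ^- n.+1 :> R by rewrite invr_gt0 exprn_gt0.
have lo : (digs 4 z n.+1)%:R * 4 ^- n.+1 <= x by exact: trunc_le_emb.
have hi : x <= (digs 4 z n.+1)%:R * 4 ^- n.+1 + 4 ^- n.+1 / 3.
  exact: (emb_le_tail z n.+1 (isT : (1 < 4)%N)).
have odz : odd (digs 4 z n.+1) = z n by rewrite /= oddD oddM /=; case: (z n).
rewrite -odz; apply/asboolP/idP => [[N /and3P[oN /asboolP NL /asboolP NU]]|od].
  move/(name_geP _ ax) in NL; move/(name_leP _ ax) in NU.
  suff -> : digs 4 z n.+1 = N by [].
  move: (digs 4 z n.+1) lo hi => M lo hi.
  move: (4 ^- n.+1) p0 lo hi NL NU => p p0 lo hi NL NU.
  apply/eqP; rewrite eqn_leq; apply/andP; split.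
    rewrite -ltnS -(ltr_nat R) -(ltr_pM2r p0) -natr1; lra.
  rewrite -ltnS -(ltr_nat R) -(ltr_pM2r p0) -natr1; lra.
exists (digs 4 z n.+1); apply/and3P; split => //; apply/asboolP.
  exact/(name_geP _ ax).
by apply/(name_leP _ ax); lra.
Qed.

(** Candidate digits are read off first. The first test checks that they expand to the given real,
    and so fails outside the image of [emb 4]; only then does the answer of [F] count. *)
Definition in_emb (F : ftype2) (a : ftype1) : bool :=
  `[< forall n, `|trunc 4 (digit4 a) n - ratval R (a n)| <= 2 ^- n + 2 ^- n >] &&
  (F (fun n => nat_of_bool (digit4 a n)) == 1%N).

Definition emb_set (F : ftype2) : set R := emb 4 @` cantor_set F.

Lemma in_embP F a (x : R) : real_name a x -> in_emb F a = `[< emb_set F x >].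
Proof.
move=> ax; apply/andP/asboolP => [[/asboolP H /eqP Fz]|[z Fz zx]].
  exists (digit4 a : cantor_space) => //.
  (* The 4 is one error for the truncation, one for the name and two for the test. *)
  apply: (@eq_of_exp2V _ _ _ 4) => // n.
  have := H n; have := ax n; have := @emb_trunc R 4 (digit4 a) n isT.
  by rewrite !ler_norml => /andP[? ?] /andP[? ?] /andP[? ?]; apply/andP; split; lra.
have dz : digit4 a = z by apply: digit4_emb; rewrite zx.
rewrite dz; split; last exact/eqP.
apply/asboolP => n; have := ax n; have := @emb_trunc R 4 z n isT; rewrite zx.
by rewrite !ler_norml => /andP[? ?] /andP[? ?]; apply/andP; split; lra.
Qed.

(** The codes 0 and 2 are those of the rationals 0 and 1. *)
Definition coindicator_rep (F : ftype2) : ftype2 :=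
  fun b => if in_emb F (fun k => b k.+1) then 0%N else 2%N.

Definition coindicator (F : ftype2) (x : R) : R := (~~ `[< emb_set F x >])%:R.

Lemma ratval0 : ratval R 0 = 0.
Proof. by rewrite /ratval /= subrr mul0r. Qed.

Lemma ratval2 : ratval R 2 = 1.
Proof. by rewrite /ratval /= subr0 divr1. Qed.

Lemma coindicator_represents F : represents (coindicator_rep F) (coindicator F).
Proof.
move=> a x _ ax n; rewrite /coindicator_rep /coindicator -(in_embP F ax).
(* Entry 0 is the requested precision; dropping it recovers the name, and the exact values 0 and 1
   suit every precision. *)
have -> : (fun k => fcons n a k.+1) = a by [].
by case: in_emb; rewrite ?ratval0 ?ratval2 subrr normr0 ltW// exp2V_gt0.
Qed.

(** Cantor space is compact, so the continuous image of a closed subset is compact, hence closed. *)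
Lemma closed_emb_set F : closed (cantor_set F) -> closed (emb_set F).
Proof.
move=> clF; apply: compact_closed; first exact: Rhausdorff.
apply: continuous_compact.
  by apply: continuous_subspaceT; exact: emb_continuous.
exact: (subclosed_compact clF cantor_space_compact).
Qed.

(** On the closed image the value 0 is minimal; off it the function is locally constant. *)
Lemma coindicator_lsc F : closed (cantor_set F) -> lsc01 (coindicator F).
Proof.
move/closed_emb_set => clK; apply/lsc01P => x0 _ e e0; rewrite /coindicator.
case: asboolP => [Kx|nKx].
  by exists 1 => // x _ _; rewrite sub0r (@lt_le_trans _ _ 0)// oppr_lt0.
have [d /= d0 Hd] : nbhs x0 (~` emb_set F) by apply: open_nbhs_nbhs; split=> //; exact: closed_openC.
exists d => // x _ xd; case: asboolP => [Kx|_]; last by rewrite ltrBlDr ltrDl.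
by case: (Hd x) => //; rewrite /= distrC.
Qed.

(** The image of [emb 4] lies below 1/3, so the value at 1 is 1. A point of the image has value 0,
    and continuity would force the value 1/2 in between. *)
Lemma coindicator_continuous F :
  {within `[0, 1], continuous (coindicator F)} <-> cantor_set F = set0.
Proof.
split=> [cf|F0]; last first.
  apply/continuous01P => x0 _ e e0; exists 1 => // x _ _.
  by rewrite /coindicator /emb_set F0 image_set0 !asboolF ?subrr ?normr0.
rewrite -subset0 => z Fz.
have c1 : coindicator F 1 = 1.
  rewrite /coindicator asboolF// => -[w _ w1].
  by have := @emb_le R 4 w isT; rewrite w1 /=; lra.
have c0 : coindicator F (emb 4 z) = 0 by rewrite /coindicator asboolT//; exists z.
have z1 : (emb 4 z : R) <= 1.
  by have := @emb_le R 4 z isT; rewrite /=; lra.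
have cf' : {within `[emb 4 z, 1], continuous (coindicator F)}.
  apply: continuous_subspaceW cf => x; rewrite /= !in_itv /= => /andP[zx ->].
  by rewrite (le_trans (emb_ge0 _ _) zx).
have [|c _] := @IVT R (coindicator F) (emb 4 z) 1 (2^-1) z1 cf'.
  by rewrite c0 c1 ge_min le_max; apply/andP; split; apply/orP; [left|right]; lra.
by rewrite /coindicator; case: (~~ _) => /=; lra.
Qed.

Lemma Omega_C_coindicator (Phi : ftype3) F v : decides_continuity_of_lsc R Phi ->
  Omega_C F = Some v -> Phi (coindicator_rep F) = Some (1 - v)%N.
Proof.
move=> HPhi; rewrite /Omega_C; case: asboolP => // -[_ clF] [<-].
rewrite (HPhi _ _ (coindicator_represents F) (coindicator_lsc clF)).
by rewrite (asbool_equiv_eq (coindicator_continuous F)); case: asboolP.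
Qed.

(** * Programs for the reduction of [Omega_C] *)

Lemma Dec_digit4 T (E : env T) (a : T -> ftype1) : has_ex2 E -> Comp1 E a ->
  Dec (bind0 E) (fun t => digit4 (a t.1) t.2).
Proof.
move=> HE ca; have HE1 := has_ex2_bind0 HE; have HE2 := has_ex2_bind0 HE1.
have HE3 := has_ex2_bind0 HE2.
pose P (t : T * nat) N := [&& odd N,
    `[< forall k, N%:R * 4 ^- t.2.+1 <= ratval R (a t.1 k) + 2 ^- k >] &
    `[< forall k, ratval R (a t.1 k) <= N%:R * 4 ^- t.2.+1 + 4 ^- t.2.+1 * 2 ^- 1 + 2 ^- k >]].
apply: (Dec_ex (P := P)) => //.
have cN : Comp (bind0 (bind0 E)) snd by exact: Comp_hd.
have cn : Comp (bind0 (bind0 E)) (fun t => t.1.2.+1).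
  exact: Comp_succ (Comp_wk0 (Comp_hd _)).
have c4 : CompQ (bind0 (bind0 (bind0 E))) (fun t => 4 ^- t.1.1.2.+1 : R).
  exact: CompQ_expV (Comp_wk0 cn).
have cp : CompQ (bind0 (bind0 (bind0 E))) (fun t => t.1.2%:R * 4 ^- t.1.1.2.+1 : R).
  by apply: CompQ_mul => //; exact: CompQ_nat (Comp_wk0 cN).
have ck : CompQ (bind0 (bind0 (bind0 E))) (fun t => 2 ^- t.2 : R).
  exact: CompQ_expV (Comp_hd _).
have c_a : CompQ (bind0 (bind0 (bind0 E))) (fun t => ratval R (a t.1.1.1 t.2)).
  apply: CompQ_ratval; apply: (Comp_app1 (f := fun t => a t.1.1.1)) (Comp_hd _).
  exact: (Comp1_wk0 (Comp1_wk0 (Comp1_wk0 ca))).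
apply: Dec_and.
  have c2 : Comp (bind0 (bind0 E)) (fun t => t.2 %/ 2 * 2)%N.
    apply: Comp_mul; last exact: Comp_cst.
    by apply: Comp_divn => //; exact: Comp_cst.
  have := Dec_not (Dec_eq cN c2); apply: eq_Dec => t.
  by rewrite -[odd _]negbK -dvdn2 dvdn_eq eq_sym.
apply: Dec_and.
  apply: (Dec_all (P := fun t k => t.2%:R * 4 ^- t.1.2.+1 <= ratval R (a t.1.1 k) + 2 ^- k)) => //.
  by apply: Dec_leQ => //; exact: CompQ_add.
apply: (Dec_all (P := fun t k =>
  ratval R (a t.1.1 k) <= t.2%:R * 4 ^- t.1.2.+1 + 4 ^- t.1.2.+1 * 2 ^- 1 + 2 ^- k)) => //.
apply: Dec_leQ => //; apply: CompQ_add => //; apply: CompQ_add => //.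
by apply: CompQ_mul => //; exact: CompQ_expV (Comp_cst _ 1).
Qed.

Lemma Comp_coindicator_rep T (E : env T) (F : T -> ftype2) b : has_ex2 E ->
  var2 E F -> Comp1 E b -> Comp E (fun t => coindicator_rep (F t) (b t)).
Proof.
move=> HE vF cb.
pose a t : ftype1 := fun k => b t k.+1.
have ca : Comp1 E a.
  apply: (Comp_app1 (f := fun t => b t.1)); first exact: Comp1_wk0.
  exact: Comp_succ (Comp_hd _).
have cd := Dec_digit4 HE ca.
apply: Comp_if; [|exact: Comp_cst|exact: Comp_cst].
apply: Dec_and; last first.
  by apply: Dec_eq; [exact: (Comp_var2 vF) | exact: Comp_cst].
apply: (Dec_all (P := fun t n =>
  `|trunc 4 (digit4 (a t)) n - ratval R (a t n)| <= 2 ^- n + 2 ^- n)) => //.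
have c2 : CompQ (bind0 E) (fun t => 2 ^- t.2 : R) by exact: CompQ_expV (Comp_hd _).
apply: Dec_distQ; last exact: CompQ_add.
  apply: (CompQ_trunc (z := fun t => digit4 (a t.1))) => //; last exact: Comp_hd.
  exact: (Comp1_wk0 (f := fun t i => nat_of_bool (digit4 (a t) i))).
exact: CompQ_ratval.
Qed.

Lemma computes_Omega_C (Phi : ftype3) :
  decides_continuity_of_lsc R Phi -> computes Phi exists_2 Omega_C.
Proof.
(* Carrying the value along with the input turns the partial [Omega_C] into a total function of the
   parameter, and makes every call to [Phi] defined. *)
move=> HPhi; pose T := {p : ftype2 * nat | Omega_C p.1 = Some p.2}.
pose E := @Env T (fun t => Args [::] [::] [:: exists_2; (sval t).1] [:: Phi])
  [:: 0; 0; 2; 1]%N (fun=> erefl).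
have HE : has_ex2 E by left; exists 0%N.
have vF : var2 E (fun t => (sval t).1) by exists 1%N.
have vPhi : var3 E (fun=> Phi) by exists 0%N.
have cF : Comp2 E (fun t => coindicator_rep (sval t).1).
  apply: (Comp_coindicator_rep (F := fun t => (sval t.1).1) (b := snd)).
  - exact: has_ex2_bind1.
  - exact: var2_bind1 vF.
  - exact: Comp1_hd.
have c1 : Comp E (fun t => 1 - (sval t).2)%N.
  by apply: (Comp_var3 vPhi cF) => -[[F v] /= Fv]; exact: Omega_C_coindicator.
have [e He] : Comp E (fun t => (sval t).2).
  (* [Phi] answers 1 exactly when [Omega_C] answers 0; as [v] is 0 or 1, a second flip recovers
     it. *)
  have := Comp_sub (Comp_cst E 1) c1; apply: eq_Comp => -[[F v] /=].
  by rewrite /Omega_C; case: asboolP => // _ [<-]; case: ifP.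
by exists e => F v Fv; exact: (He (exist _ (F, v) Fv)).
Qed.

End Converse.

Theorem theorem2p12 (R : realType) :
  (exists Phi : ftype3,
      decides_continuity_of_lsc R Phi /\ computes Omega_C suslin Phi) /\
  (forall Phi : ftype3,
      decides_continuity_of_lsc R Phi -> computes Phi exists_2 Omega_C).
Proof.
split; last exact: computes_Omega_C.
exists (@continuity_decider R); split; first exact: continuity_deciderP.
exact: computes_continuity_decider.
Qed.
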